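(* Let $V\in L^1_{\mathrm{loc}}(\mathbb{R})$ be complex-valued and periodic of period $\pi$, and suppose $\overline{V(-x)}=V(x)$ for all $x\in\mathbb{R}$ (equivalently, $\overline{V(\pi-x)}=V(x)$ for all $x\in[0,\pi]$). Then for every $j\in\mathbb{N}$, $k\in\mathbb{N}_0$ and $x_0\in[0,\pi]$, $$\overline{\mu_j(\pi-x_0)}=\mu_j(x_0)\quad\text{and}\quad \overline{\nu_k(\pi-x_0)}=\nu_k(x_0).$$
   Context: For $\lambda\in\mathbb{C}$ and $x_0\in\mathbb{R}$, let $c(\lambda,x_0,\cdot)$ and $s(\lambda,x_0,\cdot)$ be the solutions of $-\psi''+V\psi=\lambda\psi$ on $\mathbb{R}$ with $c(\lambda,x_0,x_0)=1$, $c'(\lambda,x_0,x_0)=0$, $s(\lambda,x_0,x_0)=0$, $s'(\lambda,x_0,x_0)=1$ ($'$ = derivative in the last variable). The Dirichlet eigenvalues $\mu_j(x_0)$, $j\in\mathbb{N}$, are the zeros of $\lambda\mapsto s(\lambda,x_0,x_0+\pi)$ (eigenvalues of $-d^2/dx^2+V$ on $[x_0,x_0+\pi]$ with Dirichlet conditions at both ends), and the Neumann eigenvalues $\nu_k(x_0)$, $k\in\mathbb{N}_0$, are the zeros of $\lambda\mapsto c'(\lambda,x_0,x_0+\pi)$ (Neumann conditions at both ends); each sequence is listed with multiplicity and numbered in order of non-decreasing modulus.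
   Formalization: The equality for each j (k) is read as: conjugating any admissible numbering of the eigenvalues at x_0 gives an admissible numbering at π−x_0; indexwise equality fails when moduli tie, e.g. at x_0=π/2 with non-real conjugate pairs. *)

(* Defs.v *)
From HB Require Import structures.
From mathcomp Require Import all_boot all_order all_algebra.
From mathcomp Require Import all_classical all_reals all_analysis.
From mathcomp Require Import complex.
From Stdlib Require Import ClassicalEpsilon.

Set Implicit Arguments.
Unset Strict Implicit.
Unset Printing Implicit Defensive.

Import Order.TTheory GRing.Theory Num.Theory.
Local Open Scope ring_scope.
Local Open Scope classical_set_scope.
Local Open Scope complex_scope.

Section Defs.
Context {R : realType}.
Local Notation C := R[i].
Local Notation leb := (@lebesgue_measure R).

Definition loc_integrable (f : R -> C) : Prop :=
  forall a b : R, (a <= b)%R ->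
    leb.-integrable [set x | (a <= x <= b)%R] (EFin \o (fun x => complex.Re (f x))) /\
    leb.-integrable [set x | (a <= x <= b)%R] (EFin \o (fun x => complex.Im (f x))).

Definition cint_ab (f : R -> C) (a b : R) : C :=
  (Rintegral leb [set x | (a <= x <= b)%R] (fun x => complex.Re (f x)))
  +i* (Rintegral leb [set x | (a <= x <= b)%R] (fun x => complex.Im (f x))).

Definition cint (f : R -> C) (a b : R) : C :=
  if (a <= b)%R then cint_ab f a b else - cint_ab f b a.

(* (psi, dpsi) solves -psi'' + V psi = l psi in the Caratheodory sense:
   psi is the integral of dpsi and dpsi is the integral of (V - l) psi
   (both locally absolutely continuous, dpsi = psi'). *)
Definition is_sol (V : R -> C) (l : C) (psi dpsi : R -> C) : Prop :=
  loc_integrable dpsi /\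
  loc_integrable (fun t => (V t - l) * psi t) /\
  forall a x : R,
    psi x = psi a + cint dpsi a x /\
    dpsi x = dpsi a + cint (fun t => (V t - l) * psi t) a x.

Definition fsol (V : R -> C) (l : C) (x0 : R) (p0 d0 : C) : (R -> C) * (R -> C) :=
  epsilon (inhabits ((fun _ => 0), (fun _ => 0)))
    (fun p => is_sol V l p.1 p.2 /\ p.1 x0 = p0 /\ p.2 x0 = d0).

Definition s_fun (V : R -> C) (l : C) (x0 x : R) : C := (fsol V l x0 0 1).1 x.
Definition c_der (V : R -> C) (l : C) (x0 x : R) : C := (fsol V l x0 1 0).2 x.

Definition continuous_at_c (g : C -> C) (z : C) : Prop :=
  forall e : R, (0 < e)%R -> exists2 d : R, (0 < d)%R &
    forall w, (Normc.normc (w - z) < d)%R -> (Normc.normc (g w - g z) < e)%R.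

(* z is a zero of F of order exactly n (n = 0 means F z <> 0) *)
Definition zero_order (F : C -> C) (z : C) (n : nat) : Prop :=
  exists g : C -> C, g z <> 0 /\ continuous_at_c g z /\
    forall w, F w = (w - z) ^+ n * g w.

Definition zeros_enum (F : C -> C) (m : nat -> C) : Prop :=
  (forall j, (Normc.normc (m j) <= Normc.normc (m j.+1))%R) /\
  forall (z : C) (n : nat),
    (exists s : seq nat, uniq s /\ size s = n /\ forall j, m j = z <-> j \in s)
    <-> zero_order F z n.

Definition dirichlet_enum (V : R -> C) (x0 : R) (m : nat -> C) : Prop :=
  zeros_enum (fun l => s_fun V l x0 (x0 + pi)) m.

Definition neumann_enum (V : R -> C) (x0 : R) (m : nat -> C) : Prop :=
  zeros_enum (fun l => c_der V l x0 (x0 + pi)) m.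

End Defs.

(* Main.v *)
(** Reflecting a solution [p] for [lambda] to [x |-> conj (p (pi - x))] gives, by the symmetry and
    periodicity of [V], a solution for [conj lambda]; by uniqueness this identifies
    [s (conj lambda, pi - x0, 2 pi - x0)] with [- conj (p (x0 - pi))], where [p = s (lambda, x0, .)].
    The Wronskian of [p] and its translate by [pi], evaluated at [x0] and at [x0 + pi], gives
    [p (x0 - pi) = - p (x0 + pi)].  Hence the characteristic functions at [x0] and [pi - x0] are
    conjugate to each other, with zeros of the same orders, and likewise for [c'].

    As [fsol] is chosen by [epsilon], this needs existence and uniqueness of Caratheodory solutions
    for an [L^1_loc] potential.  With [w] the sum of the norms of the coefficients and [W] its
    primitive, the [n]-th Picard increment is at most [C |W|^n / n!]; the underlying identity
    [\int w W^n = W^n.+1 / n.+1] and the constancy of the Wronskian both come from the product rule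
    for absolutely continuous functions. *)
Require Import Defs.
From HB Require Import structures.
From mathcomp Require Import all_boot all_order all_algebra.
From mathcomp Require Import all_classical all_reals all_analysis.
From mathcomp Require Import measurable_realfun complex ring lra.
Import Order.TTheory GRing.Theory Num.Theory.
Import numFieldNormedType.Exports.
Set Implicit Arguments.
Unset Strict Implicit.
Unset Printing Implicit Defensive.
Local Open Scope classical_set_scope.
Local Open Scope ring_scope.

(** * Oriented integrals of locally integrable functions *)

Section OrientedIntegral.
Context {R : realType}.
Implicit Types (f g F G : R -> R) (a b c x : R).
Local Notation mu := (@lebesgue_measure R).

(** When [b < a] the segment is empty and the condition holds trivially, so no ordering of the
    endpoints has to be carried along. *)
Definition locint f := forall a b, mu.-integrable `[a, b] (EFin \o f).

(* For a != b one of the two segments is empty. *)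
Definition oint f a b : R :=
  \int[mu]_(x in `[a, b]) f x - \int[mu]_(x in `[b, a]) f x.

Lemma oint_le f a b : a <= b -> oint f a b = \int[mu]_(x in `[a, b]) f x.
Proof.
rewrite le_eqVlt /oint => /predU1P[->|ab].
  by rewrite set_itv1 Rintegral_set1 subr0.
by rewrite [X in _ - X](_ : _ = 0) ?subr0// set_itv_ge ?Rintegral_set0// bnd_simp -ltNge.
Qed.

Lemma oint_sym f a b : oint f a b = - oint f b a.
Proof. by rewrite /oint opprB. Qed.

Lemma ointxx f a : oint f a a = 0.
Proof. by rewrite /oint subrr. Qed.

Lemma locintD f g : locint f -> locint g -> locint (fun x => f x + g x).
Proof. by move=> hf hg a b; apply: integrableD (hf a b) (hg a b). Qed.

Lemma locintZ (k : R) f : locint f -> locint (fun x => k * f x).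
Proof. by move=> hf a b; apply: integrableZl (hf a b). Qed.

Lemma locintN f : locint f -> locint (fun x => - f x).
Proof. by move=> hf a b; apply: integrableN (hf a b). Qed.

Lemma locintB f g : locint f -> locint g -> locint (fun x => f x - g x).
Proof. by move=> hf hg; apply: locintD => //; exact: locintN. Qed.

Lemma locint_norm f : locint f -> locint (fun x => `|f x|).
Proof. by move=> hf a b; apply: integrable_norm (hf a b). Qed.

Lemma locint_sum (I : finType) (f : I -> R -> R) :
  (forall i, locint (f i)) -> locint (fun x => \sum_i f i x).
Proof.
move=> hf a b.
rewrite (_ : _ \o _ = fun x => (\sum_(i : I) (f i x)%:E)%E); last first.
  by apply/funext => x /=; rewrite sumEFin.
by apply: integrable_sum => // i _; exact: hf.
Qed.

Lemma locint_cont f : continuous f -> locint f.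
Proof.
move=> cf a b; apply: continuous_compact_integrable; first exact: segment_compact.
exact: continuous_subspaceT.
Qed.

Lemma continuous_bounded G a b : continuous G ->
  exists M, forall x, a <= x <= b -> `|G x| <= M.
Proof.
move=> cG; have /compact_bounded[M [Mr HM]] : compact (G @` `[a, b]).
  by apply: continuous_compact; [exact: continuous_subspaceT|exact: segment_compact].
exists (M + 1) => x xab; apply: (HM (M + 1)); first by rewrite ltrDl.
by exists x => //=; rewrite in_itv.
Qed.

Lemma locintM f G : locint f -> continuous G -> locint (fun x => f x * G x).
Proof.
move=> hf cG a b; apply: integrableMl (hf a b) _ _ => //.
  by apply: measurable_funTS; exact: continuous_measurable_fun.
have [M HM] := continuous_bounded a b cG; exists M; split; first exact: num_real.
by move=> K MK x; rewrite /= in_itv/= => /HM/le_trans; apply; exact: ltW.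
Qed.

Lemma oint0 a b : oint (fun=> 0 : R) a b = 0.
Proof. by rewrite /oint /Rintegral !integral0 subrr. Qed.

Lemma ointD f g a b : locint f -> locint g ->
  oint (fun x => f x + g x) a b = oint f a b + oint g a b.
Proof. by move=> hf hg; rewrite /oint !RintegralD//; ring. Qed.

Lemma ointZ (k : R) f a b : locint f ->
  oint (fun x => k * f x) a b = k * oint f a b.
Proof. by move=> hf; rewrite /oint !RintegralZl// mulrBr. Qed.

Lemma eq_oint f g a b : f =1 g -> oint f a b = oint g a b.
Proof. by move=> /funext ->. Qed.

Lemma ointN f a b : locint f -> oint (fun x => - f x) a b = - oint f a b.
Proof.
by move=> hf; rewrite -mulN1r -ointZ//; apply: eq_oint => x; rewrite mulN1r.
Qed.

Lemma ointB f g a b : locint f -> locint g ->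
  oint (fun x => f x - g x) a b = oint f a b - oint g a b.
Proof. by move=> hf hg; rewrite ointD ?ointN//; exact: locintN. Qed.

Lemma oint_chasles f a b c : locint f -> oint f a b + oint f b c = oint f a c.
Proof.
move=> hf; have ord u v w : u <= v -> v <= w -> oint f u v + oint f v w = oint f u w.
  move=> uv vw; rewrite !oint_le ?(le_trans uv)//.
  (* Dropping the null point [v] from the second segment makes the two pieces disjoint. *)
  have <- := @Rintegral_itv_obnd_cbnd _ v (BRight w) f.
    by rewrite -(@Rintegral_itvB _ f (BLeft u) (BRight w) v) ?bnd_simp ?subrKC//; exact: hf.
  by apply: integrableS (hf v w) => //; exact: subset_itv_oc_cc.
have Ro u v : oint f u v = - oint f v u := oint_sym f u v.
(* Two of the eight sign patterns are contradictory; antisymmetry reduces the others to [ord]. *)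
case: (leP a b) => ab; case: (leP b c) => bc; case: (leP a c) => ac.
- exact: ord.
- by have := le_trans ab bc; rewrite leNgt ac.
- by have := ord _ _ _ ac (ltW bc); rewrite (Ro c b); lra.
- by have := ord _ _ _ (ltW ac) ab; rewrite (Ro c b) (Ro c a); lra.
- by have := ord _ _ _ (ltW ab) ac; rewrite (Ro b a); lra.
- by have := ord _ _ _ bc (ltW ac); rewrite (Ro b a) (Ro c a); lra.
- by have := lt_le_trans (lt_trans bc ab) ac; rewrite ltxx.
- by have := ord _ _ _ (ltW bc) (ltW ab); rewrite (Ro c b) (Ro c a) (Ro b a); lra.
Qed.

Lemma oint_incr f a b c : locint f -> oint f a c - oint f a b = oint f b c.
Proof. by move=> hf; rewrite -(oint_chasles a b c hf); lra. Qed.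

Lemma le_oint f g a b : a <= b -> locint f -> locint g ->
  (forall x, a <= x <= b -> f x <= g x) -> oint f a b <= oint g a b.
Proof.
move=> ab hf hg fg; rewrite !oint_le//; apply: le_Rintegral => //.
Qed.

Lemma oint_ge0 f a b : a <= b -> (forall x, 0 <= f x) -> 0 <= oint f a b.
Proof. by move=> ab f0; rewrite oint_le//; exact: Rintegral_ge0. Qed.

Lemma normr_oint f a b : a <= b -> locint f ->
  `|oint f a b| <= oint (fun x => `|f x|) a b.
Proof. by move=> ab hf; rewrite !oint_le//; exact: le_normr_Rintegral. Qed.

(** Continuity at [x] is local, so the base point is moved to [x - 1], and [x] becomes interior to a
    segment on which the parameterized integral is continuous. *)
Lemma oint_continuous f a : locint f -> continuous (oint f a).
Proof.
move=> hf x.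
have xI : x \in `]x - 1, x + 1[ by rewrite in_itv/=; apply/andP; split; lra.
have H : {within `[x - 1, x + 1], continuous
    (fun y => parameterized_integral mu (x - 1) y f)}.
  by apply: parameterized_integral_continuous => //; lra.
have ltx : x - 1 < x + 1 by lra.
have [Hc _ _] := (continuous_within_itvP _ ltx).1 H.
have -> : oint f a = fun y => oint f a (x - 1) + oint f (x - 1) y.
  by apply/funext => y; rewrite oint_chasles.
apply: cvgD; first exact: cvg_cst.
have e : forall y, x - 1 <= y -> parameterized_integral mu (x - 1) y f = oint f (x - 1) y.
  by move=> y xy; rewrite oint_le.
rewrite -e; last lra.
apply: cvg_trans (Hc x xI); apply: near_eq_cvg; near=> y; rewrite e//.
near: y; apply: lt_le_nbhsr; lra.
Unshelve. all: by end_near. Qed.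

End OrientedIntegral.

(** * Absolutely continuous functions *)

Section AbsolutelyContinuous.
Context {R : realType}.
Implicit Types (f g F G H W : R -> R) (a b c x : R).

(** Local absolute continuity in integral form: the derivative is explicit data rather than an
    almost-everywhere limit, as in [is_sol]. *)
Definition AC F f := locint f /\ forall a x, F x = F a + oint f a x.

Lemma AC_prim f a c : locint f -> AC (fun x => c + oint f a x) f.
Proof.
by move=> hf; split=> // y x; rewrite -(oint_chasles a y x hf); ring.
Qed.

Lemma AC_continuous F f : AC F f -> continuous F.
Proof.
move=> [hf HF]; have -> : F = fun x => F 0 + oint f 0 x by apply/funext => x.
by move=> x; apply: cvgD; [exact: cvg_cst|exact: oint_continuous].
Qed.

(* Splitting [a, b] into pieces of equal W-increment d, the bound K d^2 on each piece
   adds up to at most K d (W b - W a), and d is arbitrary. *)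
Lemma quadratic_increment_const H W (K : R) : 0 <= K -> continuous W ->
  (forall a b, a <= b -> W a <= W b) ->
  (forall a b, a <= b -> `|H b - H a| <= K * (W b - W a) ^+ 2) ->
  forall a b, a <= b -> H b = H a.
Proof.
move=> K0 cW Wmono HW.
have step d (n : nat) : 0 <= d -> forall a b, a <= b -> W b - W a <= n%:R * d ->
    `|H b - H a| <= K * d * (W b - W a).
  move=> d0; elim: n => [|n IH] a b ab.
    rewrite mul0r => le0; have W0 : W b - W a = 0.
      by have := Wmono _ _ ab; lra.
    by have := HW _ _ ab; rewrite W0 expr0n /= !mulr0.
  case: (leP (W b - W a) d) => [le_d _|gt_d le_n].
    apply: (le_trans (HW _ _ ab)); rewrite expr2 -mulrA ler_wpM2l//.
    by rewrite ler_wpM2r// subr_ge0 Wmono.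
  (* Cut off a last piece [[m, b]] on which [W] grows by exactly [d]; the remaining growth on
     [[a, m]] is at most [n * d], as the induction requires. *)
  have [] := @IVT _ W a b (W b - d) ab.
  - by apply: continuous_subspaceT.
  - have Wab := Wmono _ _ ab.
    by rewrite ge_min le_max; apply/andP; split; apply/orP; [left|right]; lra.
  move=> m; rewrite in_itv/= => /andP[am mb] Wm.
  have H1 := HW _ _ mb.
  have H2 : `|H m - H a| <= K * d * (W m - W a).
    by apply: IH => //; rewrite Wm; move: le_n; rewrite -natr1 mulrDl mul1r; lra.
  have -> : H b - H a = (H b - H m) + (H m - H a) by ring.
  apply: (le_trans (ler_normD _ _)).
  have -> : K * d * (W b - W a) = K * (W b - W m) ^+ 2 + K * d * (W m - W a).
    by rewrite Wm; ring.
  exact: lerD.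
move=> a b ab; apply/eqP; rewrite -subr_eq0 -normr_eq0 eq_le normr_ge0 andbT.
set D := W b - W a; have D0 : 0 <= D by rewrite subr_ge0 Wmono.
apply/ler_addgt0Pl => e e0; rewrite addr0.
have KD : 0 < K * D + 1 by have := mulr_ge0 K0 D0; lra.
(* This [d] makes [K * D * d <= e]; the summand 1 keeps the denominator positive when
   [K * D = 0]. *)
pose d := e / (K * D + 1); have d0 : 0 < d by exact: divr_gt0.
have := step d (Num.bound (D / d)) (ltW d0) a b ab.
rewrite -/D => /(_ _)/le_trans; apply.
  rewrite -ler_pdivrMr//; apply/ltW; apply: archi_boundP; exact: divr_ge0 D0 (ltW d0).
have -> : K * d * D = (K * D) * d by ring.
have -> : e = (K * D + 1) * d by rewrite /d mulrC divfK// gt_eqF.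
by rewrite ler_pM2r//; lra.
Qed.

(** The defect [H] between the product and the integral of the expected derivative has increments
    quadratic in those of the primitive of [|f| + |g|], hence is constant. *)
Lemma AC_mul F f G g : AC F f -> AC G g ->
  AC (fun x => F x * G x) (fun x => f x * G x + g x * F x).
Proof.
move=> AF AG; have cF := AC_continuous AF; have cG := AC_continuous AG.
case: AF AG => hf HF [hg HG].
have hfG := locintM hf cG; have hgF := locintM hg cF.
have hh := locintD hfG hgF; split=> //.
set h := fun x => _ in hh *.
pose w x := `|f x| + `|g x|.
have hw : locint w by apply: locintD; exact: locint_norm.
have w0 x : 0 <= w x by exact: addr_ge0.
pose H x := F x * G x - oint h 0 x.
suff Hc a b : a <= b -> H b = H a.
  move=> a b; have := oint_chasles 0 a b hh.
  have : H b = H a by case: (leP a b) => [/Hc//|/ltW/Hc].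
  by rewrite /H; lra.
apply: (@quadratic_increment_const H (oint w 0) 2) => //.
- exact: oint_continuous.
- by move=> {}a {}b ab; rewrite -subr_ge0 oint_incr// oint_ge0.
move=> {}a {}b ab; rewrite oint_incr//; set D := oint w a b.
have small E (e : R -> R) t : locint e -> (forall a x, E x = E a + oint e a x) ->
    (forall x, `|e x| <= w x) -> a <= t <= b -> `|E t - E a| <= D.
  move=> he HE ew /andP[at_ tb]; rewrite (HE a t) addrAC subrr add0r.
  apply: (le_trans (normr_oint at_ he)).
  rewrite /D -(oint_chasles a t b hw).
  rewrite -[X in X <= _]addr0 lerD// ?oint_ge0//.
  by apply: le_oint => //; exact: locint_norm.
have fw x : `|f x| <= w x by rewrite lerDl.
have gw x : `|g x| <= w x by rewrite lerDr.
(* [r] is the error made by freezing [F] and [G] at [a] in [h]. The increment of [H] is the integral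
   of [r] plus the product of the increments of [F] and [G]; each is at most [D ^+ 2], whence the
   constant 2. *)
pose r t := f t * (G a - G t) + g t * (F a - F t).
have hr : locint r.
  have cB (E : R -> R) c : continuous E -> continuous (fun t : R => c - E t).
    by move=> cE x; apply: cvgB; [exact: cvg_cst|exact: cE].
  by apply: locintD; apply: locintM => //; exact: cB.
have -> : H b - H a = oint r a b + (F b - F a) * (G b - G a).
  have -> : oint r a b = G a * oint f a b + F a * oint g a b - oint h a b.
    have h1 := locintZ (G a) hf; have h2 := locintZ (F a) hg.
    have h12 := locintD h1 h2.
    rewrite -!ointZ// -ointD// -ointB//.
    by apply: eq_oint => x; rewrite /r /h; ring.
  have := oint_chasles 0 a b hh; rewrite /H (HF a b) (HG a b) => <-; ring.
apply: (le_trans (ler_normD _ _)); rewrite mulr_natl mulr2n lerD//.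
  apply: (le_trans (normr_oint ab hr)).
  rewrite expr2 {2}/D -ointZ//; apply: le_oint => //.
  - exact: locint_norm.
  - exact: locintZ.
  move=> t tab; apply: (le_trans (ler_normD _ _)); rewrite !normrM /w mulrDr.
  have sG := small G g t hg HG gw tab; have sF := small F f t hf HF fw tab.
  by rewrite lerD// mulrC ler_wpM2r// distrC.
have bab : a <= b <= b by rewrite ab lexx.
by rewrite normrM expr2 ler_pM// ?(small F f)// ?(small G g).
Qed.

Lemma AC_exp F f n : AC F f ->
  AC (fun x => F x ^+ n.+1) (fun x => n.+1%:R * (f x * F x ^+ n)).
Proof.
move=> AF; elim: n => [|n IH].
  case: AF => hf HF; rewrite (_ : (fun x => 1 * _) = f); last first.
    by apply/funext => x; rewrite expr0 mulr1 mul1r.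
  by rewrite (_ : (fun x => F x ^+ 1) = F)//; apply/funext => x; rewrite expr1.
have := AC_mul AF IH.
rewrite (_ : (fun x => F x * F x ^+ n.+1) = fun x => F x ^+ n.+2); last first.
  by apply/funext => x; rewrite -exprS.
congr AC; apply/funext => x; rewrite -[n.+2%:R]natr1 exprS; ring.
Qed.

End AbsolutelyContinuous.

(** * Dominated convergence for oriented integrals *)

Section DominatedConvergence.
Context {R : realType}.
Implicit Types (f g : R -> R) (a b x : R).

Lemma oint_dominated_convergence (f_ : nat -> R -> R) f g :
  (forall n, locint (f_ n)) -> locint g ->
  (forall n x, `|f_ n x| <= g x) -> (forall x, f_ n x @[n --> \oo] --> f x) ->
  locint f /\ forall a b, oint (f_ n) a b @[n --> \oo] --> oint f a b.
Proof.
move=> hf_ hg fg ff.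
have H a b : (@lebesgue_measure R).-integrable `[a, b] (EFin \o f) /\
    (\int[@lebesgue_measure R]_(x in `[a, b]) f_ n x)%R @[n --> \oo] -->
    (\int[@lebesgue_measure R]_(x in `[a, b]) f x)%R.
  have mf_ n : measurable_fun `[a, b] (f_ n).
    by have /integrableP[/measurable_EFinP] := hf_ n a b.
  have mf : measurable_fun `[a, b] f.
    by apply: (measurable_fun_cvg mf_) => x _; exact: ff.
  have [||||||[intf _ Hcvg]] := @dominated_convergence _ _ R (@lebesgue_measure R)
      `[a, b] _ (fun n => EFin \o f_ n) (EFin \o f) (EFin \o g).
  - by [].
  - by move=> n; apply/measurable_EFinP; exact: mf_.
  - exact/measurable_EFinP.
  - by apply: aeW => x _; apply/cvg_EFin; [exact: nearW|exact: ff].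
  - exact: hg.
  - by apply: aeW => x n _; rewrite lee_fin; exact: fg.
  split=> //; apply: fine_cvg; rewrite fineK//.
  exact: integrable_fin_num.
split=> a b; first exact: (H a b).1.
by apply: cvgB; [exact: (H a b).2|exact: (H b a).2].
Qed.

End DominatedConvergence.

(** * Linear systems with locally integrable coefficients *)

Section LinearSystem.
Context {R : realType} {I : finType}.
Variable A : I -> I -> R -> R.
Hypothesis hA : forall i j, locint (A i j).
Implicit Types (y : I -> R -> R) (x t : R).

Definition lsol y := forall i, AC (y i) (fun x => \sum_j A i j x * y j x).

Let w x : R := \sum_i \sum_j `|A i j x|.

Let hw : locint w.
Proof.
by do 2 (apply: locint_sum => ?); exact: locint_norm.
Qed.

Let w_ge0 x : 0 <= w x.
Proof. by do 2 (apply: sumr_ge0 => ? _). Qed.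

Let field_bound y (B : R) x i : (forall j, `|y j x| <= B) ->
  `|\sum_j A i j x * y j x| <= w x * B.
Proof.
move=> yB; apply: (le_trans (ler_norm_sum _ _ _)).
apply: (@le_trans _ _ (\sum_j `|A i j x| * B)).
  by apply: ler_sum => j _; rewrite normrM ler_wpM2l.
rewrite -mulr_suml ler_wpM2r//; first exact: le_trans (yB i).
by rewrite /w [leRHS](bigD1 i)//= lerDl sumr_ge0// => k _; rewrite sumr_ge0.
Qed.

Let W x0 x : R := oint w x0 x.

(** The induction step shared by uniqueness and existence: [w * |W|^n / n!] integrates to
    [|W|^(n+1) / (n+1)!]. The bound is assumed only between [x0] and [x], since in the uniqueness
    proof it holds only on a segment. *)
Let gronwall_step (f : R -> R) (C : R) n x0 x : locint f ->
  (forall t, Num.min x0 x <= t <= Num.max x0 x ->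
     `|f t| <= w t * (C * exp_coeff `|W x0 t| n)) ->
  `|oint f x0 x| <= C * exp_coeff `|W x0 x| n.+1.
Proof.
move=> hf fC.
have cW : continuous (W x0) by exact: oint_continuous.
(* The sign [s] is 1 to the right of [x0] and -1 to the left, so that [F s] is the absolute value of
   [W x0] and remains absolutely continuous. *)
pose F (s t : R) := s * W x0 t.
pose D s t := w t * (C * exp_coeff (F s t) n).
have cF s : continuous (F s).
  by move=> t; rewrite /F; apply: cvgM; [exact: cvg_cst|exact: cW].
have cpow s : continuous (fun t => F s t ^+ n).
  by move=> t; apply: (@continuous_comp _ _ _ (F s) (fun z => z ^+ n));
    [exact: cF|exact: exprn_continuous].
have ACF s : AC (F s) (fun t => s * w t).
  split; first exact: locintZ.
  by move=> u v; rewrite ointZ// /F /W -mulrDr oint_chasles.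
have hwF s : locint (fun t => w t * F s t ^+ n) by exact: locintM.
have DE s : D s = fun t => (C / n`!%:R) * (w t * F s t ^+ n).
  by apply/funext => t; rewrite /D /exp_coeff /=; ring.
have hD s : locint (D s) by rewrite DE; exact: locintZ.
have intD s : s * s = 1 -> oint (D s) x0 x = s * (C * exp_coeff (F s x) n.+1).
  move=> ss; rewrite DE ointZ//; have [_ /(_ x0 x)] := AC_exp n (ACF s).
  have -> : F s x0 ^+ n.+1 = 0 by rewrite /F /W ointxx mulr0 expr0n.
  have -> : (fun t => n.+1%:R * (s * w t * F s t ^+ n)) =
      (fun t => (n.+1%:R * s) * (w t * F s t ^+ n)) by apply/funext => t; ring.
  rewrite ointZ// add0r /exp_coeff /= => ->.
  rewrite factS natrM.
  have n0 : n.+1%:R != 0 :> R by rewrite pnatr_eq0.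
  have f0 : n`!%:R != 0 :> R by rewrite pnatr_eq0 -lt0n fact_gt0.
  rewrite -[LHS]mul1r -{1}ss; field.
  by rewrite f0 /= addrC natr1 n0.
have nf := locint_norm hf.
case: (leP x0 x) fC => x0x fC.
  have FW t : x0 <= t -> `|W x0 t| = F 1 t.
    by move=> x0t; rewrite /F mul1r ger0_norm// oint_ge0.
  rewrite FW// -[leRHS]mul1r -intD ?mulr1//; apply: (le_trans (normr_oint x0x hf)).
  apply: le_oint => // t /andP[x0t tx]; rewrite /D -FW//; apply: fC.
  by rewrite x0t.
have FW t : t <= x0 -> `|W x0 t| = F (-1) t.
  by move=> tx0; rewrite /F mulN1r /W oint_sym normrN ger0_norm ?oint_ge0// opprK.
rewrite FW ?(ltW x0x)//.
rewrite (_ : C * _ = - (-1 * (C * exp_coeff (F (-1) x) n.+1))); last by rewrite mulN1r opprK.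
rewrite -intD ?mulrNN ?mulr1//.
rewrite oint_sym normrN -oint_sym.
apply: (le_trans (normr_oint (ltW x0x) hf)).
apply: le_oint => //; first exact: ltW.
by move=> t /andP[xt tx0]; rewrite /D -FW//; apply: fC; rewrite xt.
Qed.

(** Between [x0] and [x] the solution is bounded by some [B]. Feeding this bound back into the
    integral equation [n] times improves it to [B * |W|^n / n!], which tends to 0. *)
Let uniq0 y x0 : lsol y -> (forall i, y i x0 = 0) -> forall i x, y i x = 0.
Proof.
move=> ly y0 i x.
pose a := Num.min x0 x; pose b := Num.max x0 x.
have /choice[M HM] : forall j, exists M, forall t, a <= t <= b -> `|y j t| <= M.
  by move=> j; apply: continuous_bounded; exact: AC_continuous (ly j).
pose B := \sum_j `|M j|.
have MB j : M j <= B.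
  by rewrite (le_trans (ler_norm _))// /B (bigD1 j)//= lerDl sumr_ge0.
have B0 : 0 <= B by exact: sumr_ge0.
have yB n : forall j t, a <= t <= b -> `|y j t| <= B * exp_coeff `|W x0 t| n.
  elim: n => [|n IH] j t atb.
    by rewrite /exp_coeff /= expr0 fact0 divr1 mulr1 (le_trans (HM j t atb)).
  have [hf Hf] := ly j; rewrite (Hf x0 t) y0 add0r; apply: gronwall_step => //.
  move=> s hs; apply: field_bound => k; apply: IH.
  move: atb hs; rewrite /a /b.
  by case: (leP x0 x) => ?; case: (leP x0 t) => ?; lra.
have xab : a <= x <= b by rewrite ge_min lexx orbT le_max lexx orbT.
apply/eqP; rewrite -normr_le0.
have cv : B * exp_coeff `|W x0 x| n @[n --> \oo] --> B * 0.
  by apply: cvgM; [exact: cvg_cst|exact: cvg_exp_coeff].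
rewrite -(mulr0 B) -(cvg_lim _ cv)//; apply: limr_ge; first by apply/cvg_ex; exists (B * 0).
by apply: nearW => n; exact: yB.
Qed.

Lemma lsol_uniq y z x0 : lsol y -> lsol z -> (forall i, y i x0 = z i x0) ->
  forall i x, y i x = z i x.
Proof.
move=> ly lz yz i x; apply/eqP; rewrite -subr_eq0; apply/eqP.
apply: (@uniq0 (fun i x => y i x - z i x) x0 _ _ i x) => j; last by rewrite yz subrr.
have [hy Hy] := ly j; have [hz Hz] := lz j.
rewrite (_ : (fun x => \sum_k _) =
    (fun x => \sum_k A j k x * y k x - \sum_k A j k x * z k x)); last first.
  by apply/funext => t; rewrite -sumrB; apply: eq_bigr => k _; rewrite mulrBr.
split; first exact: locintB.
by move=> u v; rewrite ointB// (Hy u v) (Hz u v); ring.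
Qed.

(** These are the increments of the Picard iteration; the iterates are their partial sums. *)
Let picard (c : I -> R) x0 := fix u n : I -> R -> R :=
  if n is m.+1 then fun i x => oint (fun t => \sum_j A i j t * u m j t) x0 x
  else fun i _ => c i.

(** The increments are dominated by an exponential series, so the iterates [S N] converge pointwise
    under the majorant [E]; dominated convergence then carries the recursion [Srec] to the limit. *)
Lemma lsol_exists (c : I -> R) x0 : exists y, lsol y /\ forall i, y i x0 = c i.
Proof.
pose u := picard c x0.
pose S N i x := series (fun n => u n i x) N.
have cu n : (forall i, continuous (u n i)) /\
    (forall i, locint (fun t => \sum_j A i j t * u n j t)).
  suff cn : forall i, continuous (u n i).
    by split=> // i; apply: locint_sum => j; exact: locintM.
  elim: n => [|n IH] i; first by move=> x; exact: cvg_cst.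
  by apply: oint_continuous; apply: locint_sum => j; exact: locintM.
pose C : R := \sum_j `|c j|.
have C0 : 0 <= C by exact: sumr_ge0.
have uC n : forall i x, `|u n i x| <= C * exp_coeff `|W x0 x| n.
  elim: n => [|n IH] i x.
    rewrite /exp_coeff /= expr0 fact0 divr1 mulr1.
    by rewrite /C (bigD1 i)//= lerDl sumr_ge0.
  by apply: gronwall_step => [|t _]; [exact: (cu n).2|exact: field_bound].
pose E x : R := C * expR `|W x0 x|.
have cvgE x : cvgn (series (fun n => C * exp_coeff `|W x0 x| n)).
  exact: (@is_cvg_seriesZ _ _ C (is_cvg_series_exp_coeff _)).
have limE x : limn (series (fun n => C * exp_coeff `|W x0 x| n)) = E x.
  exact: (@lim_seriesZ _ _ C (is_cvg_series_exp_coeff _)).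
have SE N i x : `|S N i x| <= E x.
  apply: (@le_trans _ _ (series (fun n => C * exp_coeff `|W x0 x| n) N)).
    by apply: (le_trans (ler_norm_sum _ _ _)); apply: ler_sum.
  rewrite -limE; apply: nondecreasing_cvgn_le => //.
  apply: nondecreasing_series => n _ _.
  by rewrite mulr_ge0// exp_coeff_ge0.
have cvS i x : cvgn (fun N => S N i x).
  apply: (@normed_cvg _ R^o); apply: series_le_cvg (cvgE x) => n /=; [by []| |exact: uC].
  by rewrite mulr_ge0// exp_coeff_ge0.
pose y i x := limn (fun N => S N i x).
have cS N i : continuous (S N i).
  by apply: (continuous_big add_continuous) => n _; exact: (cu n).1.
have hS N i : locint (fun t => \sum_j A i j t * S N j t).
  by apply: locint_sum => j; exact: locintM.
have Srec N i x : S N.+1 i x = c i + oint (fun t => \sum_j A i j t * S N j t) x0 x.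
  elim: N => [|N IH].
    (* [S 0] is the empty sum, so its integral vanishes and [S 1] is the constant [c]. *)
    rewrite /S seriesSr /series /= big_geq// add0r (_ : (fun t => _) = fun=> 0).
      by rewrite oint0 addr0.
    by apply/funext => t; rewrite big1// => j _; rewrite big_geq// mulr0.
  have -> : S N.+2 i x = S N.+1 i x + u N.+1 i x by rewrite /S seriesSr.
  rewrite IH -addrA /= -ointD//; last exact: (cu N).2.
  congr (_ + _); apply: eq_oint => t; rewrite -big_split; apply: eq_bigr => j _.
  by rewrite /= -mulrDr /S seriesSr.
(* Continuity of the majorant makes [w * E] locally integrable. *)
have cE : continuous E.
  move=> x; rewrite /E; apply: cvgM; first exact: cvg_cst.
  apply: (@continuous_comp _ _ _ (fun x => `|W x0 x|) expR); last exact: continuous_expR.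
  by apply: cvg_norm; exact: oint_continuous.
have DC i : locint (fun t => \sum_j A i j t * y j t) /\
    forall a b, oint (fun t => \sum_j A i j t * S N j t) a b @[N --> \oo] -->
      oint (fun t => \sum_j A i j t * y j t) a b.
  apply: (@oint_dominated_convergence _
    (fun N t => \sum_j A i j t * S N j t) _ (fun t => w t * E t)) => //.
  - exact: locintM.
  - by move=> N t; exact: field_bound.
  - by move=> t; apply: (cvg_big add_continuous) => j _; apply: cvgM; [exact: cvg_cst|exact: cvS].
exists y.
have yE i x : y i x = c i + oint (fun t => \sum_j A i j t * y j t) x0 x.
  have h1 : S N.+1 i x @[N --> \oo] --> y i x.
    by rewrite (@cvg_shiftS _ (fun N => S N i x)); exact: cvS.
  have h2 : S N.+1 i x @[N --> \oo] --> c i + oint (fun t => \sum_j A i j t * y j t) x0 x.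
    rewrite (_ : (fun N => S N.+1 i x) =
      (fun N => c i + oint (fun t => \sum_j A i j t * S N j t) x0 x)); last first.
      by apply/funext => N; rewrite Srec.
    by apply: cvgD; [exact: cvg_cst|exact: (DC i).2].
  by rewrite -(cvg_lim _ h1)// (cvg_lim _ h2).
split=> i; last by rewrite yE ointxx addr0.
have := AC_prim x0 (c i) (DC i).1.
by rewrite (_ : (fun x => c i + _) = y i)//; apply/funext => x; rewrite -yE.
Qed.

End LinearSystem.

(** * Translation and reflection of integrals *)

Section ChangeOfVariables.
Context {R : realType}.
Implicit Types (f : R -> R) (a b c x : R).
Local Notation mu := (@lebesgue_measure R).

(** Extended by zero, both integrals live on the whole line, where the pushforward of [mu] by [phi]
    is [mu] itself. *)
Lemma integral_measure_preserving (phi : measurableTypeR R -> measurableTypeR R) (f : R -> R) (a b u v : R) :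
  measurable_fun setT phi ->
  (forall A, measurable A -> mu A = mu (phi @^-1` A)) ->
  phi @^-1` `[a, b] = `[u, v]%classic ->
  mu.-integrable `[a, b] (EFin \o f) ->
  mu.-integrable `[u, v] (EFin \o (f \o phi)) /\
  \int[mu]_(x in `[a, b]) f x = \int[mu]_(x in `[u, v]) f (phi x).
Proof.
move=> mphi phimu pre intf.
pose h : measurableTypeR R -> \bar R := (EFin \o f) \_ `[a, b].
have mab : measurable (`[a, b]%classic : set (measurableTypeR R)) by exact: measurable_itv.
have muv : measurable (`[u, v]%classic : set (measurableTypeR R)) by exact: measurable_itv.
have mh : measurable_fun setT h.
  by apply/(measurable_restrictT _ mab); exact: measurable_int intf.
have hphi : h \o phi = (EFin \o (f \o phi)) \_ `[u, v].
  apply/funext => x; rewrite /h /= !patchE -pre.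
  by rewrite (_ : (phi x \in _) = (x \in phi @^-1` `[a, b]))// !inE.
have inth : mu.-integrable setT h by apply: (integrable_mkcond _ _).1.
have inthphi : mu.-integrable setT (h \o phi).
  apply/integrableP; split; first exact: measurableT_comp.
  move/integrableP : (inth) => [_]; apply: le_lt_trans.
  rewrite -(@ge0_integral_pushforward _ _ (measurableTypeR R) (measurableTypeR R)
    R phi mphi mu setT (abse \o h))//.
    rewrite (eq_measure_integral mu); first by [].
    by move=> A mA _; exact: esym (phimu A mA).
    by apply: measurableT_comp.
  by move=> x _; exact: abse_ge0.
split.
  by apply: (integrable_mkcond _ _).2 => //; rewrite -hphi.
rewrite /Rintegral; congr fine.
rewrite [LHS]integral_mkcond [RHS]integral_mkcond -/h.
rewrite (_ : _ \_ `[u, v] = h \o phi)//.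
rewrite -(@integral_pushforward _ _ (measurableTypeR R) (measurableTypeR R) R phi mphi mu setT h)//.
by apply/esym; apply: (eq_measure_integral mu) => A mA _; exact: esym (phimu A mA).
Qed.

(** By uniqueness of Lebesgue measure, it suffices to compare the two measures on half-open
    intervals. *)
Lemma lebesgue_measure_shift c (A : set (measurableTypeR R)) : measurable A ->
  mu A = mu ((fun x => x + c) @^-1` A).
Proof.
move=> mA.
have mphi : @measurable_fun _ _ (measurableTypeR R) (measurableTypeR R) setT
    (fun x : R => x + c).
  by apply: continuous_measurable_fun => x; apply: cvgD; [exact: cvg_id|exact: cvg_cst].
pose phi : measurableTypeR R -> measurableTypeR R := fun x => x + c.
have /(_ mphi) := @lebesgue_measure_unique R (pushforward mu phi).
apply=> // _ [[a b] _ <-].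
have pre : (fun x : R => x + c) @^-1` `]a, b] = `]a - c, b - c]%classic.
  by apply/seteqP; split=> x /=; rewrite !in_itv/= => /andP[? ?]; apply/andP; split; lra.
transitivity (mu `]a - c, b - c]); last by rewrite -pre.
rewrite !lebesgue_measure_itv /= !lte_fin ltrD2r.
by case: ifP => // _; rewrite -!EFinB; congr EFin; ring.
Qed.

Lemma lebesgue_measure_opp (A : set (measurableTypeR R)) : measurable A ->
  mu A = mu (-%R @^-1` A).
Proof.
move=> mA.
have mphi : @measurable_fun _ _ (measurableTypeR R) (measurableTypeR R) setT (-%R : R -> R).
  by apply: continuous_measurable_fun; exact: opp_continuous.
pose phi : measurableTypeR R -> measurableTypeR R := -%R.
have /(_ mphi) := @lebesgue_measure_unique R (pushforward mu phi).
apply=> // _ [[a b] _ <-].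
(* Reflection moves the closed end to the left, which leaves the length unchanged. *)
have pre : -%R @^-1` `]a, b] = `[- b, - a[%classic.
  by apply/seteqP; split=> x /=; rewrite !in_itv/= => /andP[? ?]; apply/andP; split; lra.
transitivity (mu `[- b, - a[); last by rewrite -pre.
rewrite !lebesgue_measure_itv /= !lte_fin ltrN2.
by case: ifP => // _; rewrite -!EFinB; congr EFin; ring.
Qed.

Lemma oint_shift f c : locint f -> locint (fun x => f (x + c)) /\
  forall a b, oint (fun x => f (x + c)) a b = oint f (a + c) (b + c).
Proof.
move=> hf.
have H a b : mu.-integrable `[a, b] (EFin \o (fun x => f (x + c))) /\
    \int[mu]_(x in `[a + c, b + c]) f x = \int[mu]_(x in `[a, b]) f (x + c).
  apply: (@integral_measure_preserving (fun x => x + c) f) => //.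
  - by apply: continuous_measurable_fun => x; apply: cvgD; [exact: cvg_id|exact: cvg_cst].
  - exact: lebesgue_measure_shift.
  - by apply/seteqP; split=> x /=; rewrite !in_itv/= !lerD2r.
by split=> a b; [exact: (H a b).1|rewrite /oint (H a b).2 (H b a).2].
Qed.

Lemma oint_opp f : locint f -> locint (fun x => f (- x)) /\
  forall a b, oint (fun x => f (- x)) a b = - oint f (- a) (- b).
Proof.
move=> hf.
have H a b : mu.-integrable `[a, b] (EFin \o (fun x => f (- x))) /\
    \int[mu]_(x in `[- b, - a]) f x = \int[mu]_(x in `[a, b]) f (- x).
  apply: (@integral_measure_preserving -%R f) => //.
  - exact: lebesgue_measure_opp.
  - by apply/seteqP; split=> x /=; rewrite !in_itv/= !lerN2 andbC.
by split=> a b; [exact: (H a b).1|rewrite /oint (H a b).2 (H b a).2 opprB].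
Qed.

End ChangeOfVariables.

(** * Complex solutions and their symmetries *)

Local Open Scope complex_scope.

Section ComplexSolutions.
Context {R : realType}.
Implicit Types (V F G f g p d : R -> R[i]) (l : R[i]) (a b c x : R).

Lemma ReM (u v : R[i]) :
  complex.Re (u * v) = complex.Re u * complex.Re v - complex.Im u * complex.Im v.
Proof. by case: u => ? ?; case: v. Qed.

Lemma ImM (u v : R[i]) :
  complex.Im (u * v) = complex.Re u * complex.Im v + complex.Im u * complex.Re v.
Proof. by case: u => ? ?; case: v. Qed.

Lemma ReD (u v : R[i]) : complex.Re (u + v) = complex.Re u + complex.Re v.
Proof. by case: u => ? ?; case: v. Qed.

Lemma ImD (u v : R[i]) : complex.Im (u + v) = complex.Im u + complex.Im v.
Proof. by case: u => ? ?; case: v. Qed.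

Lemma ReN (u : R[i]) : complex.Re (- u) = - complex.Re u.
Proof. by case: u. Qed.

Lemma ImN (u : R[i]) : complex.Im (- u) = - complex.Im u.
Proof. by case: u. Qed.

Lemma Re_conj (u : R[i]) : complex.Re u^* = complex.Re u.
Proof. by case: u. Qed.

Lemma Im_conj (u : R[i]) : complex.Im u^* = - complex.Im u.
Proof. by case: u. Qed.

Definition reimE := (ReM, ImM, ReD, ImD, ReN, ImN, Re_conj, Im_conj).

Lemma complexP (u v : R[i]) :
  complex.Re u = complex.Re v -> complex.Im u = complex.Im v -> u = v.
Proof. by case: u => ? ?; case: v => ? ? /= -> ->. Qed.

Definition cAC F f :=
  AC (fun x => complex.Re (F x)) (fun x => complex.Re (f x)) /\
  AC (fun x => complex.Im (F x)) (fun x => complex.Im (f x)).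

Lemma loc_integrableE f : loc_integrable f <->
  locint (fun x => complex.Re (f x)) /\ locint (fun x => complex.Im (f x)).
Proof.
split=> [H|[H1 H2] a b ab]; last by rewrite -set_itvcc; split; [exact: H1|exact: H2].
split=> a b; (case: (leP a b) => [/H[H1 H2]|ba]; first by rewrite set_itvcc);
  by rewrite set_itv_ge ?bnd_simp -?ltNge//; exact: integrable_set0.
Qed.

Lemma cintE f a b :
  cint f a b = oint (fun x => complex.Re (f x)) a b +i* oint (fun x => complex.Im (f x)) a b.
Proof.
rewrite /cint /cint_ab; case: ifPn => [ab|/negP]; first by rewrite !oint_le// set_itvcc.
move=> /negP; rewrite -ltNge => /ltW ba.
by rewrite !(oint_sym _ a b) !oint_le// set_itvcc.
Qed.

Lemma is_solE V l p d :
  is_sol V l p d <-> cAC p d /\ cAC d (fun t => (V t - l) * p t).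
Proof.
rewrite /is_sol /cAC /AC !loc_integrableE; split.
  move=> [[? ?] [[? ?] H]]; split; split; split=> // a x; have [pE dE] := H a x.
  - by rewrite [in LHS]pE reimE cintE.
  - by rewrite [in LHS]pE reimE cintE.
  - by rewrite [in LHS]dE reimE cintE.
  - by rewrite [in LHS]dE reimE cintE.
move=> [[[? H1] [? H2]] [[? H3] [? H4]]]; do 2 split=> //; split.
  by apply: complexP; rewrite reimE cintE /=; [exact: H1|exact: H2].
by apply: complexP; rewrite reimE cintE /=; [exact: H3|exact: H4].
Qed.

(** * Reduction to a real system of four equations *)

(** Real form of [p' = d], [d' = q p]. The first index bit selects the derivative ([true]) or the
    function, the second the imaginary ([true]) or the real part. *)
Definition schrodinger_mx (q : R -> R[i]) (i j : bool * bool) x : R :=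
  match i, j with
  | (false, k), (true, k') => (k == k')%:R
  | (true, false), (false, false) => complex.Re (q x)
  | (true, false), (false, true) => - complex.Im (q x)
  | (true, true), (false, false) => complex.Im (q x)
  | (true, true), (false, true) => complex.Re (q x)
  | _, _ => 0
  end.

Definition re_im_system p d (i : bool * bool) x : R :=
  let z := if i.1 then d x else p x in if i.2 then complex.Im z else complex.Re z.

Lemma is_sol_lsol V l p d :
  is_sol V l p d <-> lsol (schrodinger_mx (fun x => V x - l)) (re_im_system p d).
Proof.
rewrite is_solE /lsol.
have sumE (h : bool * bool -> R) : \sum_j h j =
    h (true, true) + h (true, false) + (h (false, true) + h (false, false)).
  rewrite (eq_bigr (fun j => h (j.1, j.2))); last by case.
  by rewrite -(pair_bigA _ (fun k k' => h (k, k'))) /= !big_bool.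
have E i : (fun x => \sum_j schrodinger_mx (fun x => V x - l) i j x * re_im_system p d j x) =
    (fun x => let z := if i.1 then (V x - l) * p x else d x in
       if i.2 then complex.Im z else complex.Re z).
  apply/funext => x; rewrite sumE.
  by case: i => [[] []] /=; rewrite /re_im_system /= ?ReM ?ImM ?reimE; ring.
split=> [[[H1 H2] [H3 H4]] i|H].
  by rewrite E; case: i => [[] []].
split; split.
- by have := H (false, false); rewrite E.
- by have := H (false, true); rewrite E.
- by have := H (true, false); rewrite E.
- by have := H (true, true); rewrite E.
Qed.

Lemma schrodinger_mx_locint V l : loc_integrable V ->
  forall i j, locint (schrodinger_mx (fun x => V x - l) i j).
Proof.
move=> /loc_integrableE[h1 h2].
have hc (k : R) : locint (fun=> k) by apply: locint_cont => ?; exact: cvg_cst.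
have hr : locint (fun x => complex.Re (V x - l)).
  by under eq_fun do rewrite reimE; exact: locintD.
have hi : locint (fun x => complex.Im (V x - l)).
  by under eq_fun do rewrite reimE; exact: locintD.
by move=> [[] []] [[] []] //; first [exact: hc|exact: locintN].
Qed.

Lemma is_sol_exists V l x0 (p0 d0 : R[i]) : loc_integrable V ->
  exists p d, is_sol V l p d /\ p x0 = p0 /\ d x0 = d0.
Proof.
move=> hV.
(* Evaluating constant functions at [0] turns [(p0, d0)] into a vector of real initial values. *)
have [y [ly y0]] := lsol_exists (schrodinger_mx_locint l hV)
  (re_im_system (fun=> p0) (fun=> d0) ^~ 0) x0.
exists (fun x => y (false, false) x +i* y (false, true) x).
exists (fun x => y (true, false) x +i* y (true, true) x).
split; last by split; apply: complexP; rewrite /= y0.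
apply/is_sol_lsol; rewrite (_ : re_im_system _ _ = y)//.
by apply/funext => -[[] []].
Qed.

Lemma is_sol_uniq V l x0 p d q e : loc_integrable V ->
  is_sol V l p d -> is_sol V l q e -> p x0 = q x0 -> d x0 = e x0 ->
  p = q /\ d = e.
Proof.
move=> hV /is_sol_lsol pd /is_sol_lsol qe p0 d0.
have H := lsol_uniq (schrodinger_mx_locint l hV) pd qe (x0 := x0).
have {}H i x : re_im_system p d i x = re_im_system q e i x.
  by apply: H => -[[] []]; rewrite /re_im_system /= ?p0 ?d0.
split; apply/funext => x; apply: complexP.
- exact: H (false, false) x.
- exact: H (false, true) x.
- exact: H (true, false) x.
- exact: H (true, true) x.
Qed.

End ComplexSolutions.

(** * Wronskian, symmetries of solutions, and conjugation of zeros *)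

Section Symmetries.
Context {R : realType}.
Implicit Types (V F G f g p d q e : R -> R[i]) (l : R[i]) (a b c x : R).

Lemma AC_shift (F f : R -> R) c :
  AC F f -> AC (fun x => F (x + c)) (fun x => f (x + c)).
Proof.
move=> [hf HF]; have [h H] := oint_shift c hf.
by split=> // a x; rewrite H -HF.
Qed.

Lemma AC_reflect (F f : R -> R) :
  AC F f -> AC (fun x => F (- x)) (fun x => - f (- x)).
Proof.
move=> [hf HF]; have [h H] := oint_opp hf.
by split=> [|a x]; [exact: locintN|rewrite ointN// H opprK -HF].
Qed.

Lemma AC_opp (F f : R -> R) : AC F f -> AC (fun x => - F x) (fun x => - f x).
Proof.
move=> [hf HF]; split=> [|a x]; first exact: locintN.
by rewrite ointN// -opprD -HF.
Qed.

Lemma AC_add (F f G g : R -> R) : AC F f -> AC G g ->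
  AC (fun x => F x + G x) (fun x => f x + g x).
Proof.
move=> [hf HF] [hg HG]; split=> [|a x]; first exact: locintD.
by rewrite ointD// (HF a x) (HG a x); ring.
Qed.

Lemma eq_AC (F f F' f' : R -> R) : AC F f -> F =1 F' -> f =1 f' -> AC F' f'.
Proof. by move=> H /funext <- /funext <-. Qed.

(** In the product rule the terms [d e] and [(V - l) p q] cancel; real and imaginary parts are
    treated apart because [AC_mul] is a statement about real functions. *)
Lemma wronskian_const V l p d q e : is_sol V l p d -> is_sol V l q e ->
  forall a x, p x * e x - d x * q x = p a * e a - d a * q a.
Proof.
move=> /is_solE[[p1 p2] [d1 d2]] /is_solE[[q1 q2] [e1 e2]] a x.
apply: complexP.
- have H := AC_add
    (AC_add (AC_mul p1 e1) (AC_opp (AC_mul p2 e2)))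
    (AC_opp (AC_add (AC_mul d1 q1) (AC_opp (AC_mul d2 q2)))).
  have [h0 HW] : AC (fun x => complex.Re (p x * e x - d x * q x)) (fun=> 0).
    by apply: (eq_AC H) => t; rewrite !reimE; ring.
  by rewrite (HW a x) oint0 addr0.
- have H := AC_add
    (AC_add (AC_mul p1 e2) (AC_mul p2 e1))
    (AC_opp (AC_add (AC_mul d1 q2) (AC_mul d2 q1))).
  have [h0 HW] : AC (fun x => complex.Im (p x * e x - d x * q x)) (fun=> 0).
    by apply: (eq_AC H) => t; rewrite !reimE; ring.
  by rewrite (HW a x) oint0 addr0.
Qed.

Lemma is_sol_shift V l p d c : (forall x, V (x + c) = V x) -> is_sol V l p d ->
  is_sol V l (fun x => p (x + c)) (fun x => d (x + c)).
Proof.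
move=> Vc /is_solE[[p1 p2] [d1 d2]]; apply/is_solE.
split; split; [exact: AC_shift p1|exact: AC_shift p2| |].
- by apply: eq_AC (AC_shift c d1) _ _ => x //=; rewrite Vc.
- by apply: eq_AC (AC_shift c d2) _ _ => x //=; rewrite Vc.
Qed.

Lemma is_sol_opp V l p d : is_sol V l p d ->
  is_sol V l (fun x => - p x) (fun x => - d x).
Proof.
move=> /is_solE[[p1 p2] [d1 d2]]; apply/is_solE; split; split.
- by apply: eq_AC (AC_opp p1) _ _ => x; rewrite reimE.
- by apply: eq_AC (AC_opp p2) _ _ => x; rewrite reimE.
- by apply: eq_AC (AC_opp d1) _ _ => x; rewrite !reimE; ring.
- by apply: eq_AC (AC_opp d2) _ _ => x; rewrite !reimE; ring.
Qed.

(** Reflection changes the sign at each differentiation, hence twice in the equation, and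
    conjugation turns [V (- x) - l] into [V x - l^*]. *)
Lemma is_sol_reflect_conj V l p d : (forall x, (V (- x))^* = V x) ->
  is_sol V l p d ->
  is_sol V l^* (fun x => (p (- x))^*) (fun x => - (d (- x))^*).
Proof.
move=> Vs /is_solE[[p1 p2] [d1 d2]].
have Vs' x : V (- x) = (V x)^* by rewrite -[LHS]Vs opprK.
apply/is_solE; split; split.
- by apply: eq_AC (AC_reflect p1) _ _ => x; rewrite !reimE.
- by apply: eq_AC (AC_opp (AC_reflect p2)) _ _ => x; rewrite !reimE.
- by apply: eq_AC (AC_opp (AC_reflect d1)) _ _ => x; rewrite ?Vs' !reimE; ring.
- by apply: eq_AC (AC_reflect d2) _ _ => x; rewrite ?Vs' !reimE; ring.
Qed.

Lemma fsolP V l x0 (p0 d0 : R[i]) : loc_integrable V ->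
  let s := fsol V l x0 p0 d0 in
  is_sol V l s.1 s.2 /\ s.1 x0 = p0 /\ s.2 x0 = d0.
Proof.
move=> hV; have [p [d H]] := is_sol_exists l x0 p0 d0 hV.
exact: (@ClassicalEpsilon.epsilon_spec _ _ (fun s : (R -> R[i]) * (R -> R[i]) =>
  is_sol V l s.1 s.2 /\ s.1 x0 = p0 /\ s.2 x0 = d0) (ex_intro _ (p, d) H)).
Qed.

(** Uniqueness identifies any explicit solution with the one chosen by [epsilon]. *)
Lemma fsolE V l x0 p d : loc_integrable V -> is_sol V l p d ->
  fsol V l x0 (p x0) (d x0) = (p, d).
Proof.
move=> hV pd; have [H [p0 d0]] := fsolP l x0 (p x0) (d x0) hV.
have [] := is_sol_uniq hV H pd p0 d0.
by case: (fsol _ _ _ _ _) => ? ? /= -> ->.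
Qed.

Section SymmetricPotential.
Variables (V : R -> R[i]).
Hypotheses (hV : loc_integrable V) (Vpi : forall x, V (x + pi) = V x)
  (Vs : forall x, (V (- x))^* = V x).

Let Vpi' x : V (x - pi) = V x.
Proof. by rewrite -(Vpi (x - pi)) subrK. Qed.

(** Reflection about [pi / 2] is reflection about 0 composed with a translation by [pi]. *)
Let is_sol_mirror l p d : is_sol V l p d ->
  is_sol V l^* (fun x => (p (pi - x))^*) (fun x => - (d (pi - x))^*).
Proof.
move=> /(is_sol_reflect_conj Vs)/(is_sol_shift Vpi').
by under eq_fun do rewrite opprB; under [X in is_sol _ _ _ X]eq_fun do rewrite opprB.
Qed.

Lemma s_fun_mirror l x0 :
  s_fun V l^* (pi - x0) (pi - x0 + pi) = (s_fun V l x0 (x0 + pi))^*.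
Proof.
have [] := fsolP l x0 0 1 hV; rewrite /s_fun.
case: (fsol _ _ _ _ _) => p d /= pd [p0 d0].
(* The mirrored solution has slope -1 at [pi - x0]; negation restores the initial data of [s]. *)
have := fsolE (pi - x0) hV (is_sol_opp (is_sol_mirror pd)).
rewrite subKr p0 d0 !rmorph0 oppr0 opprK rmorph1 => ->/=.
have := wronskian_const pd (is_sol_shift Vpi' pd) x0 (x0 + pi).
rewrite /= addrK p0 d0 mulr0 mul0r subr0 sub0r mul1r mulr1 => ->.
by rewrite rmorphN (_ : pi - _ = x0 - pi)//; ring.
Qed.

Lemma c_der_mirror l x0 :
  c_der V l^* (pi - x0) (pi - x0 + pi) = (c_der V l x0 (x0 + pi))^*.
Proof.
have [] := fsolP l x0 1 0 hV; rewrite /c_der.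
case: (fsol _ _ _ _ _) => p d /= pd [p0 d0].
(* The data [(1, 0)] survive mirroring without a sign change; the Wronskian below then gives
   [d (x0 - pi) = - d (x0 + pi)]. *)
have := fsolE (pi - x0) hV (is_sol_mirror pd).
rewrite subKr p0 d0 !rmorph0 oppr0 rmorph1 => ->/=.
have := wronskian_const pd (is_sol_shift Vpi' pd) x0 (x0 + pi).
rewrite /= addrK p0 d0 mulr0 mul0r subr0 sub0r mul1r mulr1 => W.
rewrite (_ : pi - _ = x0 - pi); last by ring.
by rewrite -W rmorphN opprK.
Qed.

End SymmetricPotential.

(* [conjcK] is keyed on the ring structure of an [rcfType], which does not unify with that of [R]. *)
Lemma conjc_involutive (u : R[i]) : u^*^* = u.
Proof. by case: u => a b /=; rewrite opprK. Qed.

Lemma normc_conj (z : R[i]) : Normc.normc z^* = Normc.normc z.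
Proof. by case: z => a b; rewrite /Normc.normc /= sqrrN. Qed.

(** The cofactor becomes the conjugate of [g w^*], continuous at [z^*] because conjugation is an
    isometry. *)
Lemma zero_order_conj (D D' : R[i] -> R[i]) (z : R[i]) n :
  (forall l, D' l^* = (D l)^*) -> zero_order D z n -> zero_order D' z^* n.
Proof.
move=> DD' [g [gz [gc Dg]]]; exists (fun w => (g w^*)^*).
split; [|split].
- rewrite /= conjc_involutive; apply: contra_not gz => /(congr1 (fun u => u^*)).
  by rewrite conjc_involutive rmorph0.
- move=> eps /gc[del del0 H]; exists del => // w wz.
  rewrite /= conjc_involutive -rmorphB normc_conj; apply: H.
  by rewrite -normc_conj rmorphB /= conjc_involutive.
- by move=> w /=; rewrite -{1}[w]conjc_involutive DD' Dg rmorphM rmorphXn rmorphB /= conjc_involutive.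
Qed.

(** Conjugation preserves moduli, hence the ordering, and the indices at which the new sequence
    equals [z] are those at which [m] equals [z^*]. *)
Lemma zeros_enum_conj (D D' : R[i] -> R[i]) (m : nat -> R[i]) :
  (forall l, D' l^* = (D l)^*) -> zeros_enum D m ->
  zeros_enum D' (fun j => (m j)^*).
Proof.
move=> DD' [mono H]; split=> [j|z n]; first by rewrite !normc_conj.
have D'D l : D l^* = (D' l)^* by rewrite -{2}[l]conjc_involutive DD' conjc_involutive.
have -> : zero_order D' z n <-> zero_order D z^* n.
  split; first exact: zero_order_conj.
  by move=> /(zero_order_conj DD'); rewrite conjc_involutive.
rewrite -H; split=> -[s [us [sn Hs]]]; exists s; split=> //; split=> // j; rewrite -Hs.
- by split=> [->|<-]; rewrite conjc_involutive.
- by split=> [<-|->]; rewrite conjc_involutive.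
Qed.

End Symmetries.

(** Ordering by modulus leaves the numbering of distinct zeros of equal modulus open, so the
    equalities are expressed by carrying any admissible enumeration at [x0] to one at [pi - x0]. *)
Theorem theorem4p2 (R : realType) (V : R -> R[i]) :
  loc_integrable V ->
  (forall x : R, V (x + pi) = V x) ->
  (forall x : R, (V (- x))^* = V x) ->
  forall x0 : R, (0 <= x0 <= pi)%R ->
    (forall m : nat -> R[i], dirichlet_enum V x0 m ->
       dirichlet_enum V (pi - x0) (fun j => (m j)^*)) /\
    (forall m : nat -> R[i], neumann_enum V x0 m ->
       neumann_enum V (pi - x0) (fun j => (m j)^*)).
Proof.
move=> hV Vpi Vs x0 _; split=> m; apply: zeros_enum_conj => l.
- exact: s_fun_mirror.
- exact: c_der_mirror.
Qed.
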